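(* For every integer $\ell\ge1$, $$\hat N(2\ell+1)=\frac{3^{2\ell+1}+7}{2}-2(2\ell+1)\,{}_3F_2\left(\tfrac12,\,-\ell,\,\tfrac12-\ell;\ \tfrac32,\,1;\ 4\right),$$ $$\hat N(2\ell)=\frac{3^{2\ell}+5}{2}-4\ell\,{}_3F_2\left(\tfrac12,\,1-\ell,\,\tfrac12-\ell;\ \tfrac32,\,1;\ 4\right).$$
   Context: For $\ell\ge1$ define $$\hat N(2\ell+1)=2\Big(\sum_{j=0}^{\ell-1}\binom{2\ell+1}{2j}h_{2(\ell-j)+1,2}+1\Big)+1,\qquad \hat N(2\ell)=2\Big(\sum_{j=1}^{\ell-1}\binom{2\ell}{2j-1}h_{2\ell-2j+1,2}+1\Big)+1,$$ with empty sums equal to $0$. Here $h_{k,2}$ is the maximal number of binary words of length $k$ such that every two of them match in at least two spots; $h_{2m+1,2}=2^{2m}-\binom{2m}{m}$ and $h_{2m,2}=2^{2m-1}-\frac12\binom{2m}{m}$ for $m\ge1$. ${}_3F_2(a_1,a_2,a_3;b_1,b_2;z)=\sum_{j\ge0}\frac{(a_1)_j(a_2)_j(a_3)_j}{(b_1)_j(b_2)_j}\frac{z^j}{j!}$ with $(a)_j=a(a+1)\cdots(a+j-1)$, $(a)_0=1$; the series above terminate. *)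

(* Defs.v *)
From HB Require Import structures.
From mathcomp Require Import all_boot all_order all_algebra.
From mathcomp Require Import classical_sets reals topology normedtype sequences.

Set Implicit Arguments.
Unset Strict Implicit.
Unset Printing Implicit Defensive.

Import Order.TTheory GRing.Theory Num.Theory.
Import numFieldNormedType.Exports.

Local Open Scope ring_scope.

Definition matches (k : nat) (u v : k.-tuple bool) : nat :=
  #|[set i : 'I_k | tnth u i == tnth v i]|.

Definition pairwise_matching (k s : nat) (A : {set k.-tuple bool}) : bool :=
  [forall u in A, forall v in A, (u != v) ==> (s <= matches u v)%N].

(* The extremal number h_{k,s}; only distinct words are compared. *)
Definition hmax (k s : nat) : nat :=
  \max_(A : {set k.-tuple bool} | pairwise_matching s A) #|A|.

(* Meaningful for n >= 2, with l = n./2; in both sums j < l, so none of the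
   natural-number subtractions is truncated. *)
Definition Nhat (n : nat) : nat :=
  let l := n./2 in
  if odd n then
    (2 * (\sum_(0 <= j < l) 'C(n, 2 * j) * hmax (2 * (l - j) + 1) 2 + 1) + 1)%N
  else
    (2 * (\sum_(1 <= j < l) 'C(n, 2 * j - 1) * hmax (2 * l - 2 * j + 1) 2 + 1)
       + 1)%N.

Definition pochhammer (R : realType) (a : R) (j : nat) : R :=
  \prod_(i < j) (a + i%:R).

Definition hyp3F2_term (R : realType) (a1 a2 a3 b1 b2 z : R) (j : nat) : R :=
  (pochhammer a1 j * pochhammer a2 j * pochhammer a3 j)
    / (pochhammer b1 j * pochhammer b2 j) * (z ^+ j / (j`!)%:R).

(* The sum of the series; as for any lim, the value carries no information
   when the series diverges. *)
Definition hyp3F2 (R : realType) (a1 a2 a3 b1 b2 z : R) : R :=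
  limn (series (hyp3F2_term a1 a2 a3 b1 b2 z)).

(* Main.v *)
(* The value of h_{2m+1,2} is an inertia bound.  On words of length 2m+1,
   consider the matrix supported on the pairs u, v agreeing in exactly one
   position i, with a weight w_i independent of the pair.  It vanishes on A x A
   for every admissible family A, so #|A| is at most the number of nonnegative
   eigenvalues.  The characters S diagonalise it, with eigenvalues
   \sum_i w_i (-1)^#|S \ i|; taking w_0 = -(-1)^m and w_i = 1 otherwise, exactly
   4^m - C(2m, m) of them are nonnegative.  Words with fewer than m ones
   outside position 0 attain the bound.  Then
   Nhat n = 3 + 2 \sum_i C(n, 2i+1) (4^i - C(2i, i)): the powers of 4 sum to
   (3^n - (-1)^n) / 4, and C(n, 2i+1) C(2i, i) is n times the i-th term of the
   hypergeometric series. *)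
Require Import Defs.
From HB Require Import structures.
From mathcomp Require Import all_boot all_order all_algebra.
From mathcomp Require Import classical_sets reals topology normedtype sequences.
From mathcomp Require Import fintype finset zify ring lra.

Set Implicit Arguments.
Unset Strict Implicit.
Unset Printing Implicit Defensive.

Import Order.TTheory GRing.Theory Num.Theory.
Import numFieldNormedType.Exports.

Local Open Scope ring_scope.

(** * The inertia bound *)

(** A vector supported on [A] and orthogonal to every [chi S] with [0 <= lam S] has quadratic form
    zero by isotropy. That form is a sum of nonpositive terms, so all its coefficients vanish, and
    orthogonality makes the vector zero. *)
Lemma inertia_bound (F : realFieldType) (T X : finType) (A : {set X})
    (chi : T -> X -> F) (lam : T -> F) (c : F) :
  c != 0 ->
  {in A &, forall u v, \sum_S chi S u * chi S v = c * (u == v)%:R} ->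
  {in A &, forall u v, \sum_S lam S * (chi S u * chi S v) = 0} ->
  (#|A| <= #|[set S | (0 <= lam S)%R]|)%N.
Proof.
move=> c0 orth iso; set P := [set S | _].
pose C : 'M[F]_(#|A|, #|P|) :=
  \matrix_(i, j) chi (enum_val j) (enum_val i).
suff /eqP <- : row_free C by apply: rank_leq_col.
apply: inj_row_free => x xC0.
(* [f S] is the coefficient along [chi S] of the vector on [A] with entries [x]. *)
pose f S := \sum_i x 0 i * chi S (enum_val i).
have fP S : 0 <= lam S -> f S = 0.
  move=> lam0; have SP : S \in P by rewrite inE.
  have /matrixP/(_ 0 (enum_rank_in SP S)) := xC0.
  rewrite !mxE => <-; apply: eq_bigr => i _.
  by rewrite mxE enum_rankK_in.
have sum0 : \sum_S - (lam S * f S ^+ 2) = 0.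
  rewrite sumrN; apply/eqP; rewrite oppr_eq0; apply/eqP.
  under eq_bigr => S _.
    rewrite expr2 /f big_distrlr /= mulr_sumr.
    under eq_bigr => i _ do rewrite mulr_sumr.
    over.
  rewrite exchange_big big1 //= => i _; rewrite exchange_big big1 //= => j _.
  transitivity (x 0 i * x 0 j *
    \sum_S lam S * (chi S (enum_val i) * chi S (enum_val j))).
    by rewrite mulr_sumr; apply: eq_bigr => S _; ring.
  by rewrite iso ?mulr0 ?enum_valP.
have f0 S : f S = 0.
  have [/fP //|lam0] := lerP 0 (lam S).
  have /psumr_eq0P/(_ S isT) : \sum_S - (lam S * f S ^+ 2) = 0 by [].
  have nneg U : true -> 0 <= - (lam U * f U ^+ 2).
    move=> _; have [/fP ->|lamU] := lerP 0 (lam U).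
      by rewrite expr0n mulr0 oppr0.
    by rewrite -mulNr mulr_ge0 ?sqr_ge0 // oppr_ge0 ltW.
  move=> /(_ nneg)/eqP; rewrite oppr_eq0 mulf_eq0 (lt_eqF lam0) /=.
  by rewrite sqrf_eq0 => /eqP.
apply/rowP => i; rewrite !mxE; apply: (mulfI c0); rewrite mulr0.
transitivity (\sum_S chi S (enum_val i) * f S); last first.
  by rewrite big1 // => S _; rewrite f0 mulr0.
under eq_bigr => S _ do rewrite mulr_sumr.
rewrite exchange_big (bigD1 i) //= [X in _ + X]big1 => [|j ji]; last first.
  transitivity (x 0 j * \sum_S chi S (enum_val i) * chi S (enum_val j)).
    by rewrite mulr_sumr; apply: eq_bigr => S _; ring.
  rewrite orth ?enum_valP // (inj_eq enum_val_inj) eq_sym (negbTE ji).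
  by rewrite !mulr0.
rewrite addr0.
transitivity (x 0 i * \sum_S chi S (enum_val i) * chi S (enum_val i)).
  by rewrite orth ?enum_valP // eqxx mulr1 mulrC.
by rewrite mulr_sumr; apply: eq_bigr => S _; ring.
Qed.

(** * Characters of the cube and eigenvalues *)

(** The Walsh character, written as a product over all positions so that sums over [S] factor
    positionwise. *)
Definition character (n : nat) (S : {set 'I_n}) (u : n.-tuple bool) : rat :=
  \prod_i (if i \in S then (-1) ^+ tnth u i else 1).

Lemma character_sum (n : nat) (g : 'I_n -> rat) (u v : n.-tuple bool) :
  \sum_(S : {set 'I_n}) (\prod_i (if i \in S then g i else 1)) *
     (character S u * character S v) =
  \prod_i (g i * (-1) ^+ (tnth u i + tnth v i) + 1).
Proof.
rewrite bigA_distr /=; apply: eq_bigr => S _.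
rewrite -!big_split /=; apply: eq_bigr => i _.
by case: ifP => _; rewrite ?mul1r // exprD.
Qed.

Lemma character_orthogonal (n : nat) (u v : n.-tuple bool) :
  \sum_(S : {set 'I_n}) character S u * character S v =
  2 ^+ n * (u == v)%:R.
Proof.
transitivity (\prod_(i < n) (1 * (-1) ^+ (tnth u i + tnth v i) + 1 : rat)).
  rewrite -character_sum; apply: eq_bigr => S _.
  rewrite -[LHS]mul1r; congr (_ * _).
  by rewrite big1 // => i _; rewrite if_same.
have [<-|uv] := eqVneq u v.
  under eq_bigr => i _ do rewrite mul1r addnn -mul2n mulnC exprM sqrr_sign.
  by rewrite prodr_const card_ord mulr1.
have [i uvi] : exists i, tnth u i != tnth v i.
  apply/existsP; apply: contraNT uv; rewrite negb_exists => /forallP uv.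
  by apply/eqP/eq_from_tnth => i; apply/eqP; rewrite -[_ == _]negbK.
rewrite (bigD1 i) //= mulr0; apply/eqP; rewrite mulf_eq0; apply/orP; left.
by case: (tnth u i) (tnth v i) uvi => [] [].
Qed.

Definition eigenvalue_at (n : nat) (w : 'I_n -> rat) (S : {set 'I_n}) : rat :=
  \sum_i w i * (-1) ^+ #|S :\ i|.

(** For fixed [i] the sum factors over positions, and the factor at any [j != i] where [u] and [v]
    agree is zero. Two matches guarantee such a [j]. *)
Lemma eigenvalue_character_sum (n : nat) (w : 'I_n -> rat)
    (u v : n.-tuple bool) :
  (2 <= matches u v)%N ->
  \sum_S eigenvalue_at w S * (character S u * character S v) = 0.
Proof.
rewrite /matches => uv.
under eq_bigr => S _ do rewrite mulr_suml.
rewrite exchange_big big1 //= => i _.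
(* The sign of [#|S :\ i|] becomes a product with weight 1 at [i] and -1 elsewhere, the form
   [character_sum] requires. *)
transitivity (w i * \sum_(S : {set 'I_n})
   (\prod_j (if j \in S then (if j == i then 1 else -1) else 1)) *
   (character S u * character S v)).
  rewrite mulr_sumr; apply: eq_bigr => S _; rewrite -mulrA; congr (_ * (_ * _)).
  rewrite -prodr_const big_mkcond; apply: eq_bigr => j _.
  by rewrite !inE; case: eqP; case: (j \in S).
have [j] : exists j, j \in [set j | tnth u j == tnth v j] :\ i.
  apply/set0Pn; rewrite -card_gt0.
  by move: uv; rewrite (cardsD1 i); case: (i \in _) => //= /ltnW.
rewrite !inE => /andP[ji /eqP uvj].
rewrite character_sum (bigD1 j) //= (negbTE ji) uvj.
by case: (tnth v j); rewrite !(mulr0, mul0r).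
Qed.

(** * The value of h for odd length *)

Lemma hmax_odd_le (m : nat) :
  (0 < m)%N -> (hmax (2 * m).+1 2 <= 2 ^ (2 * m) - 'C(2 * m, m))%N.
Proof.
move=> m0; apply/bigmax_leqP => A /forall_inP matA.
(* The sign of w at ord0 makes every character with #|S :\ ord0| = m
   have a negative eigenvalue. *)
pose w (i : 'I_(2 * m).+1) : rat := if i == ord0 then - (-1) ^+ m else 1.
(* Admissibility says nothing about [u = v]; there all [2 * m + 1] positions match, which is at
   least 2 because [0 < m]. *)
have match2 : {in A &, forall u v, (2 <= matches u v)%N}.
  move=> u v uA vA; have [<-|uv] := eqVneq u v.
    rewrite /matches (_ : [set i | _] = setT) ?cardsT ?card_ord; first by lia.
    by apply/setP => i; rewrite !inE eqxx.
  by move/forall_inP: (matA u uA) => /(_ v vA)/implyP; apply.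
apply: leq_trans (inertia_bound (c := 2 ^+ (2 * m).+1) (lam := eigenvalue_at w)
  _ (in2W (@character_orthogonal _)) _) _; first by rewrite expf_neq0.
  by move=> u v uA vA; apply/eigenvalue_character_sum/match2.
have lamE S : eigenvalue_at w S = (-1) ^+ #|S :\ ord0| *
    (- (-1) ^+ m + (-1) ^+ (ord0 \in S) * ((2 * m)%:R - 2 * #|S :\ ord0|%:R)).
  have signD1 i : (-1) ^+ #|S :\ i| =
      (-1) ^+ (ord0 \in S) * (-1) ^+ #|S :\ ord0| * (-1) ^+ (i \in S) :> rat.
    rewrite -exprD -cardsD1 (cardsD1 i S) exprD mulrAC -expr2 sqrr_sign.
    by rewrite mul1r.
  have sum_sign : \sum_(i | i != ord0) (-1) ^+ (i \in S) =
      (2 * m)%:R - 2 * #|S :\ ord0|%:R :> rat.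
    transitivity (\sum_(i < (2 * m).+1 | i != ord0)
        (1 - 2 * (i \in S)%:R : rat)).
      by apply: eq_bigr => i _; case: (i \in S).
    rewrite sumrB sumr_const -mulr_sumr -natr_sum cardC1 card_ord.
    rewrite -sum1_card [in RHS]big_mkcond /= [in LHS]big_mkcond /=.
    congr (_ - _ * _%:R); apply: eq_bigr => i _.
    by rewrite !inE; case: eqP; case: (i \in S).
  rewrite /eigenvalue_at (bigD1 ord0) //= /w eqxx mulrDr; congr (_ + _).
    by rewrite mulrC.
  rewrite -sum_sign !mulr_sumr; apply: eq_bigr => i /negbTE ->.
  by rewrite signD1; ring.
set P := [set S | _].
pose D : {set 'I_(2 * m).+1} := [set~ ord0].
have cardD : #|D| = (2 * m)%N by rewrite cardsC1 card_ord.
pose middle := [set B : {set 'I_(2 * m).+1} | B \subset D & #|B| == m].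
(* Put W = [#|S :\ ord0|]. If W differs from [m], then 2m - 2W has absolute value at least 2 and
   outweighs the unit term in [lamE], so toggling [ord0] flips the sign of the eigenvalue. Hence at
   most one of the two sets with a given trace outside [ord0] lies in [P]. *)
have injP : {in P &, injective (fun S => S :\ ord0)}.
  move=> S U; rewrite !inE !lamE => lamS lamU SU; rewrite SU in lamS.
  suff : (ord0 \in S) = (ord0 \in U).
    move=> SU0; apply/setP => i; have [->//|i0] := eqVneq i ord0.
    by have /setP/(_ i) := SU; rewrite !inE i0.
  move: lamS lamU; rewrite natrM; move: #|_| => W.
  rewrite -[(-1) ^+ m]signr_odd -[(-1) ^+ W]signr_odd.
  have [Wm|mW|->] := ltngtP W m; last 1 first.
  - by case: (ord0 \in S) (ord0 \in U) (odd m) => [] [] [] //=; lra.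
  - have : W.+1%:R <= m%:R :> rat by rewrite ler_nat.
    case: (ord0 \in S) (ord0 \in U) (odd m) (odd W) => [] [] [] [] //=;
    rewrite -[W.+1]addn1 natrD; lra.
  - have : m.+1%:R <= W%:R :> rat by rewrite ler_nat.
    case: (ord0 \in S) (ord0 \in U) (odd m) (odd W) => [] [] [] [] //=;
    rewrite -[m.+1]addn1 natrD; lra.
rewrite -(card_in_imset injP).
apply: (@leq_trans #|powerset D :\: middle|).
  apply/subset_leq_card/subsetP => B /imsetP[S]; rewrite inE => lamS ->.
  rewrite !inE subDset setUCr subsetT andbT /=; apply/eqP => Sm.
  by move: lamS; rewrite lamE Sm natrM subrr mulr0 addr0 mulrN -expr2 sqrr_sign.
rewrite cardsD (setIidPr _) ?card_powerset ?cardD ?cards_draws ?cardD //.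
by apply/subsetP => B; rewrite !inE => /andP[].
Qed.

(** Complementation exchanges [light] and [heavy], so [light] has half of what [middle] leaves of
    the cube. *)
Lemma hmax_odd_ge (m : nat) :
  (2 ^ (2 * m) - 'C(2 * m, m) <= hmax (2 * m).+1 2)%N.
Proof.
pose D : {set 'I_(2 * m).+1} := [set~ ord0].
have cardD : #|D| = (2 * m)%N by rewrite cardsC1 card_ord.
pose light := [set U : {set 'I_(2 * m).+1} | (#|U :&: D| < m)%N].
pose heavy := [set U : {set 'I_(2 * m).+1} | (m < #|U :&: D|)%N].
pose middle := [set U : {set 'I_(2 * m).+1} | #|U :&: D| == m].
have cardDC (U : {set 'I_(2 * m).+1}) :
    (#|U :&: D| + #|~: U :&: D|)%N = (2 * m)%N.
  by rewrite -[RHS]cardD -(cardsID U D) setIC setDE (setIC D (~: U)).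
have heavyE : #|heavy| = #|light|.
  rewrite -(card_imset _ (can_inj setCK)); apply: eq_card => U.
  rewrite -{1}[U]setCK (mem_imset _ _ (can_inj setCK)) !inE.
  by have := cardDC U; lia.
have cover : (2 ^ (2 * m).+1 = #|light| + #|heavy| + #|middle|)%N.
  transitivity #|{: {set 'I_(2 * m).+1}}|.
    by rewrite -cardsT -powersetT card_powerset cardsT card_ord.
  rewrite -!sum1_card [in RHS]big_mkcond /= [X in (_ + X + _)%N]big_mkcond /=.
  rewrite [X in (_ + X)%N]big_mkcond -!big_split /=; apply: eq_bigr => U _.
  by rewrite !inE; case: ltngtP.
have middle_le : (#|middle| <= 2 * 'C(2 * m, m))%N.
  pose f (U : {set 'I_(2 * m).+1}) := (U :&: D, ord0 \in U).
  have f_inj : injective f.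
    move=> U V [UV U0]; apply/setP => i; have [->//|i0] := eqVneq i ord0.
    by have /setP/(_ i) := UV; rewrite !inE i0 !andbT.
  have <- : #|[set B : {set 'I_(2 * m).+1} | B \subset D & #|B| == m]| =
      'C(2 * m, m).
    by rewrite cards_draws cardD.
  rewrite -(card_imset _ f_inj).
  set B := [set B : {set _} | _]; apply: (@leq_trans #|setX B [set: bool]|).
    apply/subset_leq_card/subsetP => _ /imsetP[U + ->].
    by rewrite !inE andbT subsetIr.
  by rewrite cardsX cardsT card_bool mulnC.
have light_ge : (2 ^ (2 * m) - 'C(2 * m, m) <= #|light|)%N.
  by move: cover middle_le; rewrite heavyE expnS; lia.
apply: leq_trans light_ge _.
pose word (U : {set 'I_(2 * m).+1}) := [tuple i \in U | i < (2 * m).+1].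
have word_inj : injective word.
  move=> U V UV; apply/setP => i.
  by have /(congr1 (fun u => tnth u i)) := UV; rewrite !tnth_mktuple.
rewrite -(card_imset _ word_inj) /hmax.
apply: leq_bigmax_cond; apply/forall_inP => _ /imsetP[U + ->].
rewrite inE => lightU; apply/forall_inP => _ /imsetP[V + ->].
rewrite inE => lightV; apply/implyP => _.
rewrite /matches; set M := [set i | _].
(* Two light words differ in at most 1 + 2(m - 1) positions, hence agree in at least two of the 2m +
   1. *)
have MC_le : (#|~: M| <= 1 + (#|U :&: D| + #|V :&: D|))%N.
  apply: (@leq_trans #|ord0 |: (U :&: D :|: V :&: D)|).
    apply/subset_leq_card/subsetP => i; rewrite !inE !tnth_mktuple.
    by case: (i == ord0) (i \in U) (i \in V) => [] [] [].
  by rewrite cardsU1 leq_add ?leq_b1 // (leq_card_setU _ _).1.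
have := cardsC M; rewrite card_ord; move: lightU lightV MC_le.
move: #|M| #|~: M| #|U :&: D| #|V :&: D| => *; lia.
Qed.

(** For [m = 0] the formula fails: one word of length 1 is vacuously admissible, while the right
    side is 0. *)
Lemma hmax_odd (m : nat) :
  (0 < m)%N -> hmax (2 * m + 1) 2 = (4 ^ m - 'C(2 * m, m))%N.
Proof.
move=> m0; rewrite addn1.
rewrite (_ : 4 ^ m = 2 ^ (2 * m))%N; last by rewrite (expnM 2 2).
by apply/eqP; rewrite eqn_leq hmax_odd_le // hmax_odd_ge.
Qed.

(** * Binomial identities *)

Lemma bin_central (m : nat) : ('C(2 * m, m) * (m`! * m`!))%N = (2 * m)`!.
Proof.
have := @bin_fact (2 * m) m; rewrite (_ : 2 * m - m = m)%N; last by lia.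
by apply; lia.
Qed.

(** Ensures that the natural-number difference [4 ^ i - 'C(2 * i, i)] is not truncated when cast to
    a ring. *)
Lemma bin_central_le (m : nat) : ('C(2 * m, m) <= 4 ^ m)%N.
Proof.
rewrite (_ : 4 ^ m = 2 ^ (2 * m))%N; last by rewrite (expnM 2 2).
rewrite -[X in (2 ^ X)%N]card_ord -[in leqLHS](card_ord (2 * m)) -card_draws.
rewrite -cardsT -card_powerset; apply/subset_leq_card/fintype.subsetP => A _.
by rewrite powersetE subsetT.
Qed.

(** Subtracting the expansions of (1 - 2)^n from (1 + 2)^n leaves twice the odd-index terms, and
    2^(2i+1) = 2 * 4^i. *)
Lemma sum_odd_bin (R : numFieldType) (n K : nat) : (n <= 2 * K)%N ->
  \sum_(i < K) ('C(n, 2 * i + 1) * 4 ^ i)%:R = (3 ^+ n - (-1) ^+ n) / 4 :> R.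
Proof.
move=> nK.
(* Padding with zero binomials up to [2 * K] frees the upper limit from [n], which permits induction
   on [K]. *)
have extend (x : R) : (1 + x) ^+ n = \sum_(k < 2 * K + 1) x ^+ k *+ 'C(n, k).
  have nK1 : (n < 2 * K + 1)%N by lia.
  rewrite exprDn.
  rewrite (big_ord_widen _ (fun k => 1 ^+ (n - k) * x ^+ k *+ 'C(n, k)) nK1).
  rewrite big_mkcond /=; apply: eq_bigr => k _; rewrite expr1n mul1r.
  by case: ltnP => // nk; rewrite bin_small.
have [-> ->] : 3 = 1 + 2 :> R /\ -1 = 1 + (- 2) :> R by split; ring.
rewrite !extend -sumrB addn1; elim: K {nK extend} => [|K IH].
  by rewrite big_ord0 muln0 big_ord1 !expr0 subrr mul0r.
rewrite big_ord_recr IH (_ : (2 * K.+1 = (2 * K).+2)%N); last by lia.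
rewrite [in RHS]big_ord_recr [in RHS]big_ord_recr /=.
have -> : (- 2) ^+ (2 * K).+1 = - 2 * 4 ^+ K :> R.
  by rewrite exprS exprM; congr (_ * _ ^+ _); ring.
have -> : (- 2) ^+ (2 * K).+2 = 2 ^+ (2 * K).+2 :> R.
  by rewrite !exprS !mulrA mulrNN !exprM sqrrN.
have -> : 2 ^+ (2 * K).+1 = 2 * 4 ^+ K :> R.
  by rewrite exprS exprM; congr (_ * _ ^+ _); ring.
by rewrite addn1 natrM natrX; field.
Qed.

(** * The hypergeometric series *)

Lemma pochhammer_1 (R : realType) (i : nat) : pochhammer (1 : R) i = i`!%:R.
Proof.
rewrite /pochhammer; elim: i => [|i IH]; first by rewrite big_ord0.
by rewrite big_ord_recr IH factS natrM mulrC -natr1 addrC.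
Qed.

Lemma pochhammer_half (R : realType) (i : nat) :
  pochhammer (1 / 2 : R) i * (2 * i + 1)%:R = pochhammer (3 / 2 : R) i.
Proof.
rewrite /pochhammer; elim: i => [|i IH]; first by rewrite !big_ord0 mulr1.
by rewrite !big_ord_recr -IH /= !natrD !natrM -natr1; field.
Qed.

(** The parameters [a] and [b] interleave: 4(a + i)(b + i) = (n - 1 - 2i)(n - 2 - 2i), so their
    product telescopes into a falling factorial. The quotient of the 1/2 and 3/2 symbols is 1/(2i +
    1). *)
Lemma hyp3F2_term_bin (R : realType) (n i : nat) (a b : R) : (0 < n)%N ->
  a = (1 - n%:R) / 2 -> b = (2 - n%:R) / 2 ->
  n%:R * hyp3F2_term (1 / 2) a b (3 / 2) 1 4 i =
  ('C(n, 2 * i + 1) * 'C(2 * i, i))%:R.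
Proof.
move=> n0 aE bE.
have poch_ab : pochhammer a i * pochhammer b i * 4 ^+ i = (n.-1 ^_ (2 * i))%:R.
  rewrite /pochhammer; elim: i => [|i IH].
    by rewrite !big_ord0 !mul1r.
  rewrite !big_ord_recr exprS /=.
  transitivity ((n.-1 ^_ (2 * i))%:R * (n%:R - 1 - (2 * i)%:R) *
    (n%:R - 2 - (2 * i)%:R) : R).
    by rewrite -IH aE bE natrM; field.
  rewrite mulnSr addn2 !ffactnSr !natrM.
  have [ni|ni] := ltnP n.-1 (2 * i); first by rewrite ffact_small // !mul0r.
  rewrite natrB // -subn1 natrB // natrM.
  (* If n - 1 = 2i, the last natural subtraction truncates, but the preceding factor n - 1 - 2i is
     already zero. *)
  have [ni2|ni2] := ltnP (n - 1) (2 * i).+1.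
    have -> : (n - 1)%N = (2 * i)%N by lia.
    have -> : n%:R = 2 * i%:R + 1 :> R by rewrite -natrM natr1; congr _%:R; lia.
    ring.
  rewrite natrB; last by lia.
  rewrite natrB // -[(2 * i).+1]addn1 natrD natrM; ring.
have poch1 := pochhammer_1 R i; have poch_half := pochhammer_half R i.
have poch32 : pochhammer (3 / 2 : R) i != 0.
  by apply/prodf_neq0 => k _; apply: lt0r_neq0; apply: ltr_wpDr => //; lra.
have binE : (n * n.-1 ^_ (2 * i) = 'C(n, 2 * i + 1) * (2 * i + 1)`!)%N.
  by rewrite bin_ffact -ffactnS addn1.
have centralE := bin_central i.
have i1 : (2 * i + 1)%:R != 0 :> R by rewrite pnatr_eq0 addn1.
have fi : i`!%:R != 0 :> R by rewrite pnatr_eq0 -lt0n fact_gt0.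
rewrite /hyp3F2_term poch1.
transitivity ((n * n.-1 ^_ (2 * i))%:R /
  ((2 * i + 1)%:R * (i`!%:R * i`!%:R)) : R).
  rewrite natrM -poch_ab -poch_half; field.
  rewrite fi -natrM natr1 -addn1 i1 /=; apply: contraNneq poch32 => p0.
  by rewrite -poch_half p0 mul0r.
rewrite binE addn1 factS -centralE -addn1 !natrM; field.
by rewrite fi -natrM natr1 -addn1 i1.
Qed.

Lemma hyp3F2_swap (R : realType) (a1 a2 a3 b1 b2 z : R) :
  hyp3F2 a1 a2 a3 b1 b2 z = hyp3F2 a1 a3 a2 b1 b2 z.
Proof.
congr (limn (series _)); apply/boolp.funext => j.
by rewrite /hyp3F2_term [_ * _ * pochhammer a3 j]mulrAC.
Qed.

Lemma hyp3F2_bin (R : realType) (n K : nat) (a b : R) :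
  (0 < n)%N -> (n <= 2 * K)%N ->
  a = (1 - n%:R) / 2 -> b = (2 - n%:R) / 2 ->
  n%:R * hyp3F2 (1 / 2) a b (3 / 2) 1 4 =
  \sum_(i < K) ('C(n, 2 * i + 1) * 'C(2 * i, i))%:R.
Proof.
move=> n0 nK aE bE.
have termE i := hyp3F2_term_bin i n0 aE bE.
under eq_bigr => i _ do rewrite -termE.
rewrite -mulr_sumr; congr (_ * _); apply: cvg_lim => //.
(* Terms of index at least [K] vanish since 2i + 1 > n there, so the partial sums are eventually
   constant. *)
apply: cvg_near_cst; exists K => // m /= Km.
rewrite /series /= -(subnKC Km) (big_cat_nat _ (leq_addr _ _)) //=.
rewrite big_mkord [X in _ + X]big_nat [X in _ + X]big1 ?addr0 //.
move=> i /andP[Ki _].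
apply: (@mulfI _ n%:R); first by rewrite pnatr_eq0 -lt0n.
by rewrite termE bin_small ?mul0n ?mulr0 //; lia.
Qed.

(** * Assembling the closed forms *)

(** Reversing the sum by i = l - j and using the symmetry of binomials brings every index to the
    form 2i + 1. *)
Lemma Nhat_odd (l : nat) : Nhat (2 * l + 1) =
  (2 * (\sum_(i < l.+1)
          'C(2 * l + 1, 2 * i + 1) * (4 ^ i - 'C(2 * i, i)) + 1) + 1)%N.
Proof.
rewrite /Nhat (_ : odd (2 * l + 1) = true); last by lia.
rewrite (_ : (2 * l + 1)./2 = l)%N; last by lia.
(* The added term [i = 0] is zero, because 4^0 equals the central binomial of 0; [hmax_odd] is thus
   used only for positive indices. *)
rewrite big_ord_recl /= muln0 add0n bin0 subnn muln0 add0n.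
rewrite big_mkord (reindex_inj rev_ord_inj) /=.
congr (2 * (_ + _) + _)%N; apply: eq_bigr => i _.
have il := ltn_ord i; rewrite subKn // hmax_odd // /bump add1n.
by rewrite -bin_sub; [congr ('C(_, _) * _)%N; lia|lia].
Qed.

Lemma Nhat_even (l : nat) : (0 < l)%N -> Nhat (2 * l) =
  (2 * (\sum_(i < l) 'C(2 * l, 2 * i + 1) * (4 ^ i - 'C(2 * i, i)) + 1) + 1)%N.
Proof.
case: l => // l _.
rewrite /Nhat (_ : odd (2 * l.+1) = false); last by lia.
rewrite (_ : (2 * l.+1)./2 = l.+1)%N; last by lia.
rewrite big_ord_recl /= muln0 add0n bin0 subnn muln0 add0n.
rewrite big_add1 /= big_mkord (reindex_inj rev_ord_inj) /=.
congr (2 * (_ + _) + _)%N; apply: eq_bigr => i _.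
have il := ltn_ord i.
rewrite (_ : 2 * l.+1 - 2 * (l - i.+1).+1 = 2 * i.+1)%N; last by lia.
rewrite hmax_odd // /bump add1n.
by rewrite -bin_sub; [congr ('C(_, _) * _)%N; lia|lia].
Qed.

(** Treats both parities at once: the sign of (-1)^n accounts for the constants 7 and 5, and [a],
    [b] are -l, 1/2 - l for n = 2l + 1 and 1/2 - l, 1 - l for n = 2l. *)
Lemma Nhat_hyp3F2 (R : realType) (n K : nat) (a b : R) :
  (0 < n)%N -> (n <= 2 * K)%N ->
  a = (1 - n%:R) / 2 -> b = (2 - n%:R) / 2 ->
  (2 * (\sum_(i < K) 'C(n, 2 * i + 1) * (4 ^ i - 'C(2 * i, i)) + 1) + 1)%:R =
  (3 ^+ n - (-1) ^+ n + 6) / 2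
    - 2 * n%:R * hyp3F2 (1 / 2) a b (3 / 2) 1 4 :> R.
Proof.
move=> n0 nK aE bE; rewrite -mulrA (hyp3F2_bin n0 nK aE bE).
rewrite natrD natrM natrD natr_sum.
under eq_bigr => i _ do rewrite mulnBr natrB ?leq_mul ?bin_central_le //.
by rewrite sumrB sum_odd_bin //; field.
Qed.

Theorem proposition7p2 (R : realType) (l : nat) (hl : (1 <= l)%N) :
  (Nhat (2 * l + 1))%:R =
    (3 ^+ (2 * l + 1) + 7) / 2
    - 2 * (2 * l + 1)%:R
      * hyp3F2 (1 / 2) (- l%:R) (1 / 2 - l%:R) (3 / 2) 1 4 :> R
  /\
  (Nhat (2 * l))%:R =
    (3 ^+ (2 * l) + 5) / 2
    - 4 * l%:R
      * hyp3F2 (1 / 2) (1 - l%:R) (1 / 2 - l%:R) (3 / 2) 1 4 :> R.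
Proof.
have sign_even : (-1) ^+ (2 * l) = 1 :> R by rewrite exprM sqrrN !expr1n.
split.
- rewrite Nhat_odd (@Nhat_hyp3F2 _ _ _ (- l%:R) (1 / 2 - l%:R)).
  + by congr (_ / _ - _); rewrite [(-1) ^+ _]exprD sign_even; ring.
  + by rewrite addn1.
  + by lia.
  + by rewrite natrD natrM; field.
  + by rewrite natrD natrM; field.
(* For even n the integral parameter is (2 - n)/2, listed first in the goal but second in
   [Nhat_hyp3F2]. *)
- rewrite Nhat_even // hyp3F2_swap.
  rewrite (@Nhat_hyp3F2 _ _ _ (1 / 2 - l%:R) (1 - l%:R)) ?muln_gt0 //.
  + by rewrite sign_even natrM mulrA -natrM; congr (_ / _ - _); ring.
  + by rewrite natrM; field.
  + by rewrite natrM; field.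
Qed.
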